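(* Assume (R) and let $n\ge1$ be odd. Then $A_n(x)=(2x-1)F_n(x(x-1))$, where for all $k\ge0$ $$(-1)^kf_{n,k}=[x^k]\,S_{n,2k}(x)=\frac1{k!}\frac{d^k}{dx^k}A^\star_{n,2k}(x)\Big|_{x=1}.$$ Here $S_{n,2k}(x)\in\mathbb C[[x]]$ for $0\le k\le d_n$ and $S_{n,2k}(x)\in\mathbb C[x]$ for $k>d_n$, in which case $S_{n,2k}$ is anti-palindromic: $S_{n,2k}(x)=-x^{2k}S_{n,2k}(x^{-1})$. The coefficients satisfy $f_{n,0}=-\alpha_n$, $f_{n,d_n}=\tfrac12\alpha_0$, $f_{n,k}=0$ for $k>d_n$, and for $0\le k\le n$ $$f_{n,k}=(-1)^k\sum_{\nu=0}^{k}\binom{2k-n}{k-\nu}s_{n,\nu}=(-1)^{k+1}\sum_{\nu=0}^{k}\binom{2k-\nu}{k}\binom{n}{\nu}\alpha_{n-\nu}.$$ For the even index $n+1$: $A_{n+1}(x)=F_{n+1}(x(x-1))$ with $f_{n+1,0}=\alpha_{n+1}$, $f_{n+1,k}=\frac{n+1}{k}f_{n,k-1}$ for $1\le k<d_{n+1}$, $f_{n+1,d_{n+1}}=\alpha_0$, and $f_{n+1,k}=0$ for $k>d_{n+1}$.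
   Context: Let $(\alpha_n)_{n\ge0}$ be an arbitrary sequence of complex numbers with Appell polynomials $A_n(x)=\sum_{\nu=0}^{n}\binom{n}{\nu}\alpha_{n-\nu}x^\nu$; property (R) means $A_n(1-x)=(-1)^nA_n(x)$ for all $n\ge0$. For $n\ge0,k\in\mathbb Z$ let $A^\star_{n,k}(x)=x^kA_n(x^{-1})$. Let $s_{n,k}=\sum_{\nu=k}^{n}\binom{n}{\nu}\binom{\nu}{k}\alpha_\nu$, $S_n(x)=\sum_{k=0}^n s_{n,k}x^k$, and the formal power series $S_{n,k}(x)=S_n(x)(x+1)^{k-n}=S_n(x)\sum_{\nu\ge0}\binom{k-n}{\nu}x^\nu$ (generalized binomial coefficients, also used in $\binom{2k-n}{k-\nu}$). $[x^k]$ denotes the coefficient of $x^k$. Let $d_n=\lfloor n/2\rfloor$, $\delta_n=1$ if $n$ odd, $0$ otherwise. Under (R), for each $n$ there is a unique polynomial $F_n(u)=\sum_{k\ge0}f_{n,k}u^k$ of degree at most $d_n$ with $A_n(x)=(2x-1)^{\delta_n}F_n(x(x-1))$ (explicitly $f_{n,k}=2^{2k-n}\sum_{\nu=0}^{d_n-k}\binom{n}{2\nu}\binom{d_n-\nu}{k}S_{2\nu}(1)$ for $k\le d_n$), with $f_{n,k}=0$ for $k>d_n$. *)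

(* Defs.v *)
From HB Require Import structures.
From mathcomp Require Import all_boot all_order all_algebra.
Set Implicit Arguments. Unset Strict Implicit. Unset Printing Implicit Defensive.
Import Order.TTheory GRing.Theory Num.Theory.
Local Open Scope ring_scope.

Section Defs.
Variable C : numClosedFieldType.
Variable alpha : nat -> C.

Definition Appell (n : nat) : {poly C} :=
  \sum_(nu < n.+1) (('C(n, nu))%:R * alpha (n - nu)%N) *: 'X^nu.

Definition propR : Prop :=
  forall n : nat, Appell n \Po (1 - 'X) = (-1) ^+ n *: Appell n.

Definition scoef (n k : nat) : C :=
  \sum_(k <= nu < n.+1) ('C(n, nu) * 'C(nu, k))%:R * alpha nu.
Definition Spoly (n : nat) : {poly C} := \poly_(k < n.+1) scoef n k.

Definition gbinom (a : int) (m : nat) : C :=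
  (\prod_(i < m) (a - i%:Z)%:~R) / (m`!)%:R.

(* formal power series S_{n,k}(x) = S_n(x) (x+1)^{k-n}, given by its
   coefficient sequence: [x^j] S_{n,k} = sum_{i<=j} [x^i]S_n * binom(k-n, j-i) *)
Definition Sser (n : nat) (k : int) (j : nat) : C :=
  \sum_(i < j.+1) (Spoly n)`_i * gbinom (k - n%:Z) (j - i)%N.

(* Laurent polynomials as finite lists of (exponent, coefficient) terms *)
Definition lpoly := seq (int * C).
Definition leval (p : lpoly) (x : C) : C := \sum_(t <- p) t.2 * x ^ t.1.
Definition lderiv (p : lpoly) : lpoly := [seq (t.1 - 1, t.2 * t.1%:~R) | t <- p].

(* A*_{n,k}(x) = x^k A_n(x^{-1}) = sum_nu binom(n,nu) alpha_{n-nu} x^(k-nu) *)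
Definition Astar (n : nat) (k : int) : lpoly :=
  [seq (k - nu%:Z, ('C(n, nu))%:R * alpha (n - nu)%N) | nu <- iota 0 n.+1].

End Defs.

Definition dfl (n : nat) : nat := n./2.
Arguments gbinom {C}.

(* Main.v *)
(** For a fixed weight w, the functional sending a polynomial p to the sum of
    its coefficients p_i times w(i) is [wsum w p].  By Vandermonde's identity
    [x^j] S_{n,K} is the value at A_n of the functional with weight
    binom(K - i, j).  If the weights c(a - i, m) obey Pascal's rule,
    multiplication by x(x-1) lowers (a, m) to (a - 2, m - 1) and changes the
    sign; so weight c(2k - i, k) sends (2x-1)(x(x-1))^j to 0 unless j = k.
    Applied to A_n = (2x-1) F_n(x(x-1)), it extracts f_{n,k}: generalized
    binomials give (-1)^k f_{n,k}, while binomials cut off to 0 at negative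
    upper index give (-1)^(k+1) f_{n,k}, whence the two closed formulas.
    The even index follows from A_{n+1}' = (n+1) A_n, i.e.
    F_{n+1}' = (n+1) F_n, and anti-palindromy from A_n(1-x) = -A_n(x). *)

Require Import Defs.
From HB Require Import structures.
From mathcomp Require Import all_boot all_order all_algebra.
From mathcomp Require Import ring.
Import Order.TTheory GRing.Theory Num.Theory.
Local Open Scope ring_scope.

Set Implicit Arguments.
Unset Strict Implicit.
Unset Printing Implicit Defensive.

(** * Binomial coefficients with integer upper index *)

Section GeneralizedBinomial.
Variable C : numClosedFieldType.
Implicit Types (a : int) (m : nat).

Lemma factr_neq0 m : (m`!)%:R != 0 :> C.
Proof. by rewrite pnatr_eq0 -lt0n fact_gt0. Qed.

Lemma gbinom0 a : gbinom a 0 = 1 :> C.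
Proof. by rewrite /gbinom big_ord0 fact0 divr1. Qed.

(** All three terms share the factor a(a-1)...(a-m+1); what remains is a + 1 = (a - m) + (m + 1). *)
Lemma gbinomS a m : gbinom (a + 1) m.+1 = gbinom a m.+1 + gbinom a m :> C.
Proof.
rewrite /gbinom big_ord_recl [in RHS]big_ord_recr.
have E (i : nat) : a + 1 - i.+1%:Z = a - i%:Z by rewrite -addn1 PoszD; ring.
under eq_bigr => i _ do rewrite lift0 E.
rewrite factS natrM subr0 rmorphD rmorphB /= -pmulrn.
have := factr_neq0 m; have : (m.+1)%:R != 0 :> C by rewrite pnatr_eq0.
by rewrite -[m.+1]addn1 natrD => *; field; apply/andP.
Qed.

Lemma gbinom_pascal a m :
  gbinom a m.+1 = gbinom (a - 1) m.+1 + gbinom (a - 1) m :> C.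
Proof. by rewrite -gbinomS subrK. Qed.

Lemma gbinom_nat (N m : nat) : gbinom N%:Z m = 'C(N, m)%:R :> C.
Proof.
elim: N m => [|N IHN] [|m]; rewrite ?gbinom0 ?bin0 //.
  by rewrite /gbinom big_ord_recl subrr mul0r mul0r.
by rewrite -addn1 PoszD gbinomS !IHN addn1 binS natrD.
Qed.

(** Induction on [mu]: Pascal's rule for binom(mu+1, i) on the left matches Pascal's rule in the
    upper index on the right. *)
Lemma gbinom_vandermonde a (mu j : nat) :
  \sum_(i < j.+1) 'C(mu, i)%:R * gbinom a (j - i) = gbinom (a + mu%:Z) j :> C.
Proof.
elim: mu j => [|mu IH] j.
  rewrite big_ord_recl bin0 mul1r subn0 big1 ?addr0 // => i _.
  by rewrite mul0r.
case: j => [|j].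
  by rewrite big_ord_recl big_ord0 !gbinom0 bin0 mulr1 addr0.
have -> : a + mu.+1%:Z = a + mu%:Z + 1 by rewrite -addn1 PoszD addrA.
rewrite gbinomS -!IH.
rewrite [in LHS]big_ord_recl [X in _ = X + _]big_ord_recl -addrA !bin0.
congr (_ + _); rewrite -big_split; apply: eq_bigr => i _.
by rewrite lift0 binS natrD mulrDl subSS.
Qed.

(** By symmetry the two Pascal summands of a central binomial coefficient are equal. This supplies
    the hypothesis [c_central] below. *)
Lemma double_bin m : 'C(2 * m.+1, m.+1) = ('C((2 * m.+1).-1, m.+1)).*2.
Proof.
rewrite mul2n doubleS /= binS -[RHS]addnn; congr (_ + _)%N.
have le : (m.+1 <= m.*2.+1)%N by rewrite ltnS -addnn leq_addr.
by rewrite -(bin_sub le) subSS -addnn addnK.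
Qed.
End GeneralizedBinomial.

(** * Weighted coefficient sums as linear functionals *)

Section WeightedCoefficientSum.
Variable C : numClosedFieldType.
Implicit Types (w : nat -> C) (p : {poly C}).

Definition wsum w p : C := \sum_(i < size p) p`_i * w i.

Lemma wsum_widen N w p : (size p <= N)%N ->
  wsum w p = \sum_(i < N) p`_i * w i.
Proof.
move=> le_pN; rewrite /wsum (big_ord_widen _ (fun i => p`_i * w i) le_pN).
rewrite big_mkcond; apply: eq_bigr => i _.
by case: ltnP => // le_pi; rewrite nth_default ?mul0r.
Qed.

Lemma wsum_is_linear w : linear_for *%R (wsum w).
Proof.
move=> a p q; pose N := maxn (size p) (size q).
have leN : (size (a *: p + q)%R <= N)%N.
  apply: leq_trans (size_polyD _ _) _.
  by rewrite geq_max leq_maxr (leq_trans (size_scale_leq _ _)) ?leq_maxl.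
rewrite !(@wsum_widen N) ?leq_maxl ?leq_maxr //.
rewrite mulr_sumr -big_split; apply: eq_bigr => i _ /=.
by rewrite coefD coefZ mulrDl mulrA.
Qed.

HB.instance Definition _ w :=
  GRing.isLinear.Build C {poly C} C *%R (wsum w) (wsum_is_linear w).

Lemma eq_wsum w1 w2 p : w1 =1 w2 -> wsum w1 p = wsum w2 p.
Proof. by move=> E; apply: eq_bigr => i _; rewrite E. Qed.

Lemma wsumXn w i : wsum w 'X^i = w i.
Proof.
rewrite /wsum size_polyXn big_ord_recr /= coefXn eqxx mul1r big1 ?add0r // => j _.
by rewrite coefXn ltn_eqF // mul0r.
Qed.

Lemma wsumXM w p : wsum w ('X * p) = wsum (fun i => w i.+1) p.
Proof.
rewrite (@wsum_widen (size p).+1); last first.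
  by have [->|nz] := eqVneq p 0; rewrite ?mulr0 ?size_poly0 // -commr_polyX size_mulX.
rewrite big_ord_recl coefXM eqxx mul0r add0r.
by apply: eq_bigr => i _; rewrite coefXM lift0.
Qed.

Lemma wsumB_weight w1 w2 p : wsum (fun i => w1 i - w2 i) p = wsum w1 p - wsum w2 p.
Proof. by rewrite /wsum -sumrB; apply: eq_bigr => i _; rewrite mulrBr. Qed.

Lemma wsumQM w p : wsum w ('X * ('X - 1) * p) =
  wsum (fun i => w i.+2 - w i.+1) p.
Proof.
by rewrite -mulrA wsumXM mulrBl mul1r raddfB /= wsumXM wsumB_weight.
Qed.

Section PascalWeights.
Variable c : int -> nat -> C.
Hypothesis c_pascal : forall a m, c a m.+1 = c (a - 1) m.+1 + c (a - 1) m.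
Hypothesis c_neg : forall i : nat, c (- i.+2%:Z) 0%N = c (- i.+1%:Z) 0%N.
Hypothesis c_central : forall m : nat,
  c (2 * m.+1)%N m.+1 = c ((2 * m.+1)%N%:Z - 1) m.+1 *+ 2.

(** Induction on [j]: a factor x(x-1) lowers [j] and [k] together, at the cost of a sign. For j = 0
    < k the value 2c(2k-1, k) - c(2k, k) vanishes by [c_central]. For k = 0 < j the differences
    vanish because, by [c_neg], the weights are constant at negative upper index. *)
Lemma wsum_basis (j k : nat) :
  wsum (fun i => c ((2 * k)%N%:Z - i%:Z) k)
       (('X * ('X - 1)) ^+ j * ('X *+ 2 - 1)) =
  (j == k)%:R * ((-1) ^+ k * (c (-1) 0%N *+ 2 - c 0 0%N)).
Proof.
elim: j k => [|j IHj] k.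
  rewrite expr0 mul1r raddfB raddfMn /= -{1}['X]expr1 -(expr0 'X) !wsumXn.
  case: k => [|k]; first by rewrite muln0 !sub0r oppr0 !mul1r.
  by rewrite subr0 c_central subrr mul0r.
rewrite exprS -mulrA wsumQM; case: k => [|k].
  rewrite mul0r /wsum big1 // => i _.
  by rewrite muln0 !sub0r c_neg subrr mulr0.
have E (i : nat) : c ((2 * k.+1)%N%:Z - i.+2%:Z) k.+1
    - c ((2 * k.+1)%N%:Z - i.+1%:Z) k.+1 = -1 * c ((2 * k)%N%:Z - i%:Z) k.
  rewrite (c_pascal (_ - i.+1%:Z)).
  rewrite (_ : _ - i.+1%:Z - 1 = (2 * k)%N%:Z - i%:Z); last first.
    by rewrite mulnS -[i.+1]addn1 !PoszD; ring.
  rewrite (_ : _ - i.+2%:Z = (2 * k)%N%:Z - i%:Z); last first.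
    by rewrite mulnS -[i.+2]addn2 !PoszD; ring.
  by ring.
rewrite (eq_wsum _ E).
transitivity (-1 * wsum (fun i => c ((2 * k)%N%:Z - i%:Z) k)
   (('X * ('X - 1)) ^+ j * ('X *+ 2 - 1))).
  by rewrite /wsum mulr_sumr; apply: eq_bigr => i _; rewrite mulrCA.
by rewrite IHj eqSS exprS; ring.
Qed.

Lemma wsum_odd_symmetric (F : {poly C}) (k : nat) :
  wsum (fun i => c ((2 * k)%N%:Z - i%:Z) k)
       (('X *+ 2 - 1) * (F \Po ('X * ('X - 1)))) =
  F`_k * ((-1) ^+ k * (c (-1) 0%N *+ 2 - c 0 0%N)).
Proof.
rewrite mulrC comp_polyE mulr_suml raddf_sum /=.
under eq_bigr => j _ do rewrite -scalerAl linearZ /= wsum_basis.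
have [le_Fk|lt_kF] := leqP (size F) k.
  rewrite nth_default // mul0r big1 // => j _.
  by rewrite ltn_eqF ?mul0r ?mulr0 // (leq_trans _ le_Fk).
rewrite (bigD1 (Ordinal lt_kF)) //= eqxx mul1r big1 ?addr0 // => j nj.
by rewrite (_ : (j == k :> nat) = false) ?mul0r ?mulr0 //; apply: negbTE.
Qed.
End PascalWeights.
End WeightedCoefficientSum.

(** * Polynomials in x(x-1) and the symmetry x -> 1 - x *)

Section ReflectionSymmetry.
Variable C : numClosedFieldType.
Implicit Types (p q F G : {poly C}).

Lemma size_XX1 : size ('X * ('X - 1) : {poly C}) = 3%N.
Proof. by rewrite -commr_polyX size_mulX ?polyXsubC_eq0 // size_XsubC. Qed.

Lemma comp_XX1_inj F G :
  F \Po ('X * ('X - 1)) = G \Po ('X * ('X - 1)) -> F = G.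
Proof.
move/eqP; rewrite -subr_eq0 -comp_polyB comp_poly_eq0 ?size_XX1 // subr_eq0.
by move/eqP.
Qed.

Lemma monic_XX1 : 'X * ('X - 1) \is @monic C.
Proof. by rewrite monicMl ?monicX // monicXsubC. Qed.

(** Since x(x-1) is monic of degree 2, only its N-th power reaches degree 2N. *)
Lemma coef_comp_XX1 N G : (size G <= N.+1)%N ->
  (G \Po ('X * ('X - 1)))`_N.*2 = G`_N.
Proof.
move=> le_G; rewrite coef_comp_poly.
have sizeQ i : size (('X * ('X - 1)) ^+ i : {poly C}) = i.*2.+1.
  by rewrite -[LHS]prednK ?size_poly_gt0 ?expf_neq0 ?monic_neq0 ?monic_XX1 //
    size_exp size_XX1 mul2n.
have coefQ : ((('X * ('X - 1)) ^+ N)`_N.*2 : C) = 1.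
  by have /monicP := monic_exp N monic_XX1; rewrite /lead_coef sizeQ.
have coefQ0 i : (i < N)%N -> ((('X * ('X - 1)) ^+ i)`_N.*2 : C) = 0.
  by move=> lt_iN; rewrite nth_default // sizeQ ltn_double.
have [le_GN|lt_NG] := leqP (size G) N.
  rewrite nth_default // big1 // => i _.
  by rewrite coefQ0 ?mulr0 // (leq_trans _ le_GN).
rewrite (bigD1 (Ordinal lt_NG)) //= coefQ mulr1 big1 ?addr0 // => i ni.
rewrite coefQ0 ?mulr0 // ltn_neqAle -ltnS (leq_trans (ltn_ord i) le_G) andbT.
exact: ni.
Qed.

(** Induction on [N]: p - p(0) vanishes at 0, hence by symmetry at 1, so x(x-1) divides it. The
    quotient is again invariant, with degree bound lowered by two. *)
Lemma reflection_invariantP N p :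
  (size p <= N.*2.+1)%N -> p \Po (1 - 'X) = p ->
  exists2 G : {poly C}, (size G <= N.+1)%N & p = G \Po ('X * ('X - 1)).
Proof.
elim: N p => [|N IHN] p le_p sym_p.
  by exists p; rewrite // (size1_polyC le_p) comp_polyC.
have /factor_theorem[q] : root (p - p.[0]%:P) 0.
  by rewrite /root !hornerE subrr.
rewrite subr0 => def_q.
have q1 : q.[1] = 0.
  have := congr1 (fun r => r.[1]) def_q.
  rewrite !hornerE => <-; rewrite -[in p.[1]]sym_p horner_comp !hornerE subrr.
  by rewrite subrr.
have /factor_theorem[r def_r] : root q 1 by apply/eqP.
have def_p : p = r * ('X * ('X - 1)) + p.[0]%:P.
  by rewrite -[LHS](subrK p.[0]%:P) def_q def_r -mulrA [_ * 'X]mulrC.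
have symQ : ('X * ('X - 1)) \Po (1 - 'X) = 'X * ('X - 1) :> {poly C}.
  by rewrite comp_polyM comp_polyB comp_polyX -polyC1 comp_polyC; ring.
have nzQ : 'X * ('X - 1) != 0 :> {poly C} by rewrite -size_poly_gt0 size_XX1.
have sym_r : r \Po (1 - 'X) = r.
  apply: (mulIf nzQ); apply: (addIr p.[0]%:P); rewrite -def_p -{2}sym_p {2}def_p.
  by rewrite comp_polyD comp_polyM symQ comp_polyC.
have le_r : (size r <= N.*2.+1)%N.
  have [->|nz_r] := eqVneq r 0; first by rewrite size_poly0.
  have := leq_trans (size_polyD p (- p.[0]%:P)) _.
  move=> /(_ N.+1.*2.+1); rewrite geq_max le_p size_polyN.
  rewrite (leq_trans (size_polyC_leq1 _)) // => /(_ isT).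
  rewrite def_q def_r -mulrA [_ * 'X]mulrC size_mul // size_XX1.
  by rewrite addn3 doubleS.
have [H le_H def_H] := IHN r le_r sym_r.
exists (H * 'X + p.[0]%:P); last by rewrite comp_poly_MXaddC -def_H.
by rewrite size_MXaddC; case: ifP.
Qed.

End ReflectionSymmetry.

(** * Binomial weights under the reflection x -> 1 - x *)

Section BinomialWeights.
Variable C : numClosedFieldType.
Implicit Types (p : {poly C}) (a : int).

(** By Pascal's rule each factor 1 - x lowers both indices of the weight by one; at lower index 0
    the weight is constant and the factor kills it. *)
Lemma wsum_gbinom_subX a (j nu : nat) :
  wsum (fun i => gbinom (a - i%:Z) j) ((1 - 'X) ^+ nu : {poly C}) =
  if (nu <= j)%N then gbinom (a - nu%:Z) (j - nu) else 0.
Proof.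
elim: nu a j => [|nu IHnu] a j.
  by rewrite expr0 -(expr0 'X) wsumXn subn0.
rewrite exprS mulrBl mul1r raddfB /= wsumXM -wsumB_weight.
case: j => [|j].
  by rewrite /wsum big1 // => i _; rewrite !gbinom0 subrr mulr0.
have E (i : nat) : gbinom (a - i%:Z) j.+1 - gbinom (a - i.+1%:Z) j.+1 =
    gbinom (a - 1 - i%:Z) j :> C.
  have -> : a - i.+1%:Z = a - i%:Z - 1 by rewrite -addn1 PoszD; ring.
  by rewrite gbinom_pascal addrC addKr addrAC.
rewrite (eq_wsum _ E) IHnu ltnS subSS; congr (if _ then gbinom _ _ else _).
by rewrite -[nu.+1]addn1 PoszD; ring.
Qed.

(** On x^i this is the symmetry binom(N-i, j-i) = binom(N-i, N-j). It turns reflection of A_n into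
    reversal of the coefficients of S_{n,N}. *)
Lemma wsum_gbinom_reflection (N j : nat) p : (size p <= N.+1)%N -> (j <= N)%N ->
  wsum (fun i => gbinom (N%:Z - i%:Z) j) (p \Po (1 - 'X)) =
  wsum (fun i => gbinom (N%:Z - i%:Z) (N - j)) p.
Proof.
move=> le_pN le_jN; rewrite comp_polyE raddf_sum; apply: eq_bigr => i _ /=.
rewrite linearZ /= wsum_gbinom_subX; congr (_ * _).
have le_iN : (i <= N)%N by rewrite -ltnS (leq_trans _ le_pN).
rewrite subzn // !gbinom_nat; case: leqP => [le_ij|lt_ji].
  by rewrite -bin_sub ?leq_sub2r // subnBA // subnK.
by rewrite bin_small // ltn_sub2l // (leq_trans lt_ji).
Qed.

End BinomialWeights.

(** * The two weight families that extract f_{n,k} *)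

Section PascalWeightInstances.
Variable C : numClosedFieldType.
Implicit Types (F : {poly C}) (a : int).

(* The cut-off keeps Pascal's rule for every lower index m + 1; it only breaks
   down at lower index 0, between a = -1 and a = 0. *)
Definition nnbinom a (m : nat) : C := if a is Posz N then 'C(N, m)%:R else 0.

Lemma nnbinom_pascal a m :
  nnbinom a m.+1 = nnbinom (a - 1) m.+1 + nnbinom (a - 1) m.
Proof.
case: a => [[|N]|N]; rewrite ?addr0 //.
by rewrite (_ : N.+1%:Z - 1 = N) /= ?binS ?natrD // -addn1 PoszD addrK.
Qed.

Lemma predz_double m : (2 * m.+1)%N%:Z - 1 = ((2 * m.+1).-1)%N.
Proof. by rewrite -subn1 -subzn // muln_gt0. Qed.

Lemma wsum_gbinom_odd_symmetric F (k : nat) :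
  wsum (fun i => gbinom ((2 * k)%N%:Z - i%:Z) k)
       (('X *+ 2 - 1) * (F \Po ('X * ('X - 1)))) = (-1) ^+ k * F`_k.
Proof.
rewrite wsum_odd_symmetric; first by rewrite !gbinom0; ring.
- exact: gbinom_pascal.
- by move=> i; rewrite !gbinom0.
by move=> m; rewrite predz_double !gbinom_nat double_bin -mul2n natrM mulr_natl.
Qed.

(** The cut-off gives c(-1, 0) = 0, so the constant 2c(-1, 0) - c(0, 0) is -1, against 1 for
    [gbinom]; hence the extra sign. *)
Lemma wsum_nnbinom_odd_symmetric F (k : nat) :
  wsum (fun i => nnbinom ((2 * k)%N%:Z - i%:Z) k)
       (('X *+ 2 - 1) * (F \Po ('X * ('X - 1)))) = (-1) ^+ k.+1 * F`_k.
Proof.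
rewrite wsum_odd_symmetric; first by rewrite /= bin0 exprS; ring.
- exact: nnbinom_pascal.
- by [].
by move=> m; rewrite predz_double /nnbinom double_bin -mul2n natrM mulr_natl.
Qed.

End PascalWeightInstances.

(** * Appell polynomials, the series S_{n,k} and derivatives of A*_{n,k} *)

Section AppellPolynomials.
Variables (C : numClosedFieldType) (alpha : nat -> C).

Lemma size_Appell n : (size (Appell alpha n) <= n.+1)%N.
Proof.
apply: leq_trans (size_sum _ _ _) _; apply/bigmax_leqP => i _.
by rewrite (leq_trans (size_scale_leq _ _)) // size_polyXn ltnS -ltnS.
Qed.

Lemma coef_Appell n i : (i <= n)%N ->
  (Appell alpha n)`_i = 'C(n, i)%:R * alpha (n - i)%N.
Proof.
move=> le_in; rewrite -ltnS in le_in; rewrite coef_sum.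
rewrite (bigD1 (Ordinal le_in)) //= coefZ coefXn eqxx mulr1 big1 ?addr0 // => j nj.
rewrite coefZ coefXn [i == j]eq_sym.
by rewrite (_ : (j == i :> nat) = false) ?mulr0 //; apply: negbTE.
Qed.

Lemma wsum_Appell w n : wsum w (Appell alpha n) =
  \sum_(nu < n.+1) 'C(n, nu)%:R * alpha (n - nu)%N * w nu.
Proof.
rewrite raddf_sum /=; apply: eq_bigr => i _.
by rewrite linearZ /= wsumXn.
Qed.

Lemma deriv_Appell n : (Appell alpha n.+1)^`() = n.+1%:R *: Appell alpha n.
Proof.
rewrite /Appell raddf_sum big_ord_recl /= expr0 derivZ derivC scaler0 add0r scaler_sumr.
apply: eq_bigr => i _; rewrite /bump add1n derivZ derivXn /= subSS -scaler_nat !scalerA.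
by congr (_ *: _); rewrite [RHS]mulrA -natrM (mul_bin_diag n.+1) natrM; ring.
Qed.

Lemma scoef_sum n k : scoef alpha n k =
  \sum_(nu < n.+1) 'C(n, nu)%:R * alpha nu * 'C(nu, k)%:R.
Proof.
rewrite /scoef -(big_mkord xpredT (fun nu => 'C(n, nu)%:R * alpha nu * 'C(nu, k)%:R)).
have small m : (m <= k)%N ->
    \sum_(0 <= nu < m) 'C(n, nu)%:R * alpha nu * 'C(nu, k)%:R = 0.
  move=> le_mk; rewrite big_nat big1 // => nu /= lt_nu.
  by rewrite ['C(nu, k)]bin_small ?mulr0 // (leq_trans lt_nu).
have [le_kn|lt_nk] := leqP k n.+1; last first.
  by have le_nk := ltnW lt_nk; rewrite small // big_geq.
rewrite [RHS](big_cat_nat (leq0n k) le_kn) /= small // add0r.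
by apply: eq_bigr => nu _; rewrite natrM mulrAC.
Qed.

Lemma coef_Spoly n i : (Spoly alpha n)`_i = scoef alpha n i.
Proof.
rewrite coef_poly; case: ltnP => // lt_ni.
by rewrite /scoef big_geq.
Qed.

Lemma Sser_wsum n (K : int) j :
  Sser alpha n K j = wsum (fun i => gbinom (K - i%:Z) j) (Appell alpha n).
Proof.
(* With mu = n - nu, the weight binom(K - nu, j) is binom((K - n) + mu, j), the form to which
   Vandermonde applies. *)
rewrite wsum_Appell [RHS](reindex_inj rev_ord_inj) /= /Sser.
under [LHS]eq_bigr => i _ do rewrite coef_Spoly scoef_sum mulr_suml.
rewrite exchange_big; apply: eq_bigr => mu _ /=.
have le_mun : (mu <= n)%N by rewrite -ltnS.
rewrite subSS subKn // bin_sub // -subzn // opprB [mu%:Z - _]addrC addrA.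
rewrite -gbinom_vandermonde mulr_sumr; apply: eq_bigr => i _.
by rewrite mulrA.
Qed.

(** Each derivative brings down the current exponent, so x^e contributes the falling factorial of e
    at x = 1. The induction peels off the derivative applied first, hence the general [s]. *)
Lemma leval_iter_lderiv k (s : lpoly C) :
  leval (iter k (@lderiv C) s) 1 = \sum_(t <- s) t.2 * \prod_(i < k) (t.1 - i%:Z)%:~R.
Proof.
elim: k s => [|k IHk] s.
  by apply: eq_bigr => t _; rewrite big_ord0 exp1rz.
rewrite iterSr IHk big_map; apply: eq_bigr => t _.
rewrite big_ord_recl subr0 mulrA; congr (_ * _); apply: eq_bigr => i _ /=.
by rewrite /bump add1n -add1n PoszD opprD addrA.
Qed.

Lemma Sser_Astar n (K : int) k : Sser alpha n K k =
  k`!%:R^-1 * leval (iter k (@lderiv C) (Astar alpha n K)) 1.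
Proof.
rewrite leval_iter_lderiv Sser_wsum wsum_Appell big_map -[iota 0 n.+1]/(index_iota 0 n.+1).
rewrite big_mkord mulr_sumr; apply: eq_bigr => nu _ /=.
by rewrite /gbinom; ring.
Qed.

End AppellPolynomials.

(** * The expansions of A_n and A_{n+1} for odd n *)

Theorem mainTheorem17 (C : numClosedFieldType) (alpha : nat -> C) (n : nat) :
  propR alpha -> (1 <= n)%N -> odd n ->
  (* existence of F_n and F_{n+1} *)
  (exists F : {poly C}, (size F <= (dfl n).+1)%N /\
      Appell alpha n = ('X *+ 2 - 1) * (F \Po ('X * ('X - 1)))) /\
  (exists G : {poly C}, (size G <= (dfl n.+1).+1)%N /\
      Appell alpha n.+1 = G \Po ('X * ('X - 1))) /\
  (forall F G : {poly C},
    (size F <= (dfl n).+1)%N ->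
    Appell alpha n = ('X *+ 2 - 1) * (F \Po ('X * ('X - 1))) ->
    (size G <= (dfl n.+1).+1)%N ->
    Appell alpha n.+1 = G \Po ('X * ('X - 1)) ->
    (* odd index n *)
    (forall k : nat,
       (-1) ^+ k * F`_k = Sser alpha n (2 * k)%N k /\
       Sser alpha n (2 * k)%N k =
         (k`!)%:R^-1 * leval (iter k (@lderiv C) (Astar alpha n (2 * k)%N)) 1) /\
    (forall k : nat, (dfl n < k)%N ->
       exists p : {poly C}, (forall j, Sser alpha n (2 * k)%N j = p`_j) /\
         (forall j, (2 * k < j)%N -> p`_j = 0) /\
         (forall j, (j <= 2 * k)%N -> p`_j = - p`_(2 * k - j))) /\
    F`_0 = - alpha n /\
    F`_(dfl n) = 2^-1 * alpha 0%N /\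
    (forall k : nat, (dfl n < k)%N -> F`_k = 0) /\
    (forall k : nat, (k <= n)%N ->
       F`_k = (-1) ^+ k *
         \sum_(nu < k.+1) gbinom ((2 * k)%N%:Z - n%:Z) (k - nu)%N * scoef alpha n nu /\
       F`_k = (-1) ^+ k.+1 *
         \sum_(nu < k.+1) ('C((2 * k - nu)%N, k) * 'C(n, nu))%:R * alpha (n - nu)%N) /\
    (* even index n+1 *)
    G`_0 = alpha n.+1 /\
    (forall k : nat, (1 <= k)%N -> (k < dfl n.+1)%N ->
       G`_k = (n.+1)%:R / k%:R * F`_(k.-1)) /\
    G`_(dfl n.+1) = alpha 0%N /\
    (forall k : nat, (dfl n.+1 < k)%N -> G`_k = 0)).
Proof.
move=> symA n_gt0 odd_n.
have def_n : n = (dfl n).*2.+1 by rewrite -[LHS]odd_double_half odd_n.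
have def_d1 : dfl n.+1 = (dfl n).+1 by rewrite {1}def_n /dfl -doubleS doubleK.
have nz_n1 : n.+1%:R != 0 :> C by rewrite pnatr_eq0.
have derivQ : ('X * ('X - 1))^`() = 'X *+ 2 - 1 :> {poly C}.
  by rewrite derivM derivB derivX derivC; ring.
have nz_2X1 : 'X *+ 2 - 1 != 0 :> {poly C}.
  apply/eqP => /(congr1 (fun p => p.[0])) /eqP.
  by rewrite !hornerE oppr_eq0 oner_eq0.
have derivA G : Appell alpha n.+1 = G \Po ('X * ('X - 1)) ->
    n.+1%:R *: Appell alpha n = ('X *+ 2 - 1) * (G^`() \Po ('X * ('X - 1))).
  by move=> def_G; rewrite -deriv_Appell def_G deriv_comp derivQ mulrC.
have exG : exists G : {poly C}, (size G <= (dfl n.+1).+1)%N /\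
    Appell alpha n.+1 = G \Po ('X * ('X - 1)).
  have [||G leG defG] := @reflection_invariantP C (dfl n.+1) (Appell alpha n.+1).
  - by rewrite def_d1 doubleS -def_n size_Appell.
  - by rewrite symA -signr_odd /= odd_n expr0 scale1r.
  by exists G.
split; [|split=> //].
  have [G [le_G def_G]] := exG.
  (* F_n is obtained from F_{n+1}: differentiating F_{n+1}(x(x-1)) produces the factor 2x - 1. *)
  exists (n.+1%:R^-1 *: G^`()); split.
    rewrite (leq_trans (size_scale_leq _ _)) //.
    apply/leq_sizeP => j lt_dj; rewrite coef_deriv nth_default ?mul0rn //.
    by rewrite (leq_trans le_G) // def_d1 ltnS.
  by rewrite comp_polyZ -scalerAr -derivA // scalerA mulVf // scale1r.
move=> F G le_F def_F le_G def_G.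
have coefF k : (-1) ^+ k * F`_k = Sser alpha n (2 * k)%N k.
  by rewrite Sser_wsum def_F wsum_gbinom_odd_symmetric.
have F_big k : (dfl n < k)%N -> F`_k = 0.
  by move=> lt_dk; rewrite nth_default // (leq_trans le_F).
have derivG : G^`() = n.+1%:R *: F.
  apply/comp_XX1_inj/(mulfI nz_2X1).
  by rewrite -derivA // def_F comp_polyZ scalerAr.
have coefG k : G`_k.+1 = n.+1%:R / k.+1%:R * F`_k.
  have := congr1 (fun p : {poly C} => p`_k) derivG.
  rewrite coef_deriv coefZ => E.
  by rewrite mulrAC -E -[G`_k.+1 *+ _]mulr_natr mulfK // pnatr_eq0.
(* The ratio (n+1)/(d_n+1) = 2 is the source of the factor 1/2 in f_{n,d_n}. *)
have two_d : n.+1%:R = 2 * (dfl n).+1%:R :> C.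
  by rewrite {1}def_n -doubleS -mul2n natrM.
have nz_d1 : (dfl n).+1%:R != 0 :> C by rewrite pnatr_eq0.
have nz_2 : 2 != 0 :> C by rewrite pnatr_eq0.
have G_lead : G`_(dfl n.+1) = alpha 0%N.
  rewrite -(coef_comp_XX1 le_G) -def_G def_d1 doubleS -def_n.
  by rewrite coef_Appell // binn mul1r subnn.
have F_lead : F`_(dfl n) = 2^-1 * alpha 0%N.
  by rewrite -G_lead def_d1 coefG two_d mulfK // mulKf.
split; first by move=> k; rewrite coefF -Sser_Astar.
split.
  (* As 2k > n, all upper indices 2k - i with i <= n are natural numbers, so coefficients beyond
     degree 2k vanish. *)
  move=> k lt_dk; have le_n2k : (n < 2 * k)%N.
    by rewrite def_n mul2n -doubleS leq_double.
  exists (\poly_(j < (2 * k).+1) Sser alpha n (2 * k)%N j); split=> [j|].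
    rewrite coef_poly ltnS; case: leqP => // lt_kj.
    rewrite Sser_wsum wsum_Appell big1 // => i _.
    have le_i : (i <= 2 * k)%N by rewrite ltnW // (leq_trans _ le_n2k).
    by rewrite subzn // gbinom_nat ['C(_, j)]bin_small ?mulr0 // (leq_ltn_trans (leq_subr _ _)).
  split=> j; rewrite !coef_poly ltnS; first by rewrite ltnNge; case: leqP.
  move=> le_j; rewrite le_j ltnS leq_subr !Sser_wsum.
  have le_A : (size (Appell alpha n) <= (2 * k).+1)%N.
    by rewrite (leq_trans (size_Appell _ _)) // ltnS ltnW.
  rewrite -(wsum_gbinom_reflection le_A le_j) symA -signr_odd odd_n expr1 scaleN1r.
  by rewrite raddfN opprK.
split.
  (* At x = 0 the factor 2x - 1 is -1 and x(x-1) is 0. *)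
  have := congr1 (fun p : {poly C} => p.[0]) def_F.
  rewrite !hornerE horner_comp !hornerE mulN1r => E.
  by rewrite -[LHS]opprK -horner_coef0 -E horner_coef0 coef_Appell // bin0 mul1r subn0.
split=> //; split=> //; split.
  move=> k le_kn; split.
    rewrite -[LHS](signrMK k) coefF; congr (_ * _).
    rewrite /Sser; apply: eq_bigr => i _; rewrite coef_Spoly mulrC; congr (gbinom _ _ * _).
  rewrite -[LHS](signrMK k.+1) -wsum_nnbinom_odd_symmetric -def_F wsum_Appell.
  congr (_ * _).
  (* The sum over nu <= n stops at k: for k < nu <= 2k the upper index 2k - nu is below k, and for
     nu > 2k it is negative, where [nnbinom] is 0. *)
  rewrite (big_ord_widen n.+1
    (fun nu => ('C((2 * k - nu)%N, k) * 'C(n, nu))%:R * alpha (n - nu)%N)) //.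
  rewrite [RHS]big_mkcond; apply: eq_bigr => i _; rewrite ltnS.
  have [le_ik|lt_ki] := leqP i k.
    rewrite subzn; last by rewrite (leq_trans le_ik) // leq_pmull.
    by rewrite natrM; ring.
  have [le_i2k|lt_2ki] := leqP i (2 * k).
    rewrite subzn //= ['C(_, k)]bin_small ?mulr0 // mul2n -addnn.
    by rewrite ltn_subLR ?ltn_add2r // addnn -mul2n.
  case E: (_ - _) => [N|N]; last by rewrite mulr0.
  have : 0 <= (2 * k)%N%:Z - i%:Z by rewrite E.
  by rewrite subr_ge0 lez_nat leqNgt lt_2ki.
split.
  have := congr1 (fun p : {poly C} => p.[0]) def_G.
  rewrite horner_comp !hornerE => E.
  by rewrite -horner_coef0 -E horner_coef0 coef_Appell // bin0 mul1r subn0.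
split; first by case=> // k _ _; rewrite coefG.
split=> // k lt_dk.
by rewrite nth_default // (leq_trans le_G).
Qed.
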